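(* Being a network is a quasi-isometry invariant of group pairs: if $(G,\mathcal{P})$ and $(H,\mathcal{Q})$ are quasi-isometric group pairs, then $(G,\mathcal{P})$ is a $\sigma$-network for some $\sigma\ge0$ if and only if $(H,\mathcal{Q})$ is a $\tau$-network for some $\tau\ge0$.
   Context: A group pair $(G,\mathcal{P})$ is a finitely generated group $G$ together with a finite collection $\mathcal{P}$ of infinite subgroups of $G$. $G$ carries a fixed word metric $\mathrm{dist}_G$ with respect to a finite generating set; $\mathrm{hdist}_G$ is the Hausdorff distance and $\mathcal{N}_r(A)$ the closed $r$-neighborhood of $A$. $G/\mathcal{P}$ is the set of all left cosets $gP$, $g\in G$, $P\in\mathcal{P}$. $(G,\mathcal{P})$ and $(H,\mathcal{Q})$ are quasi-isometric if there are a quasi-isometry $q\colon G\to H$ and $M>0$ such that for every $A\in G/\mathcal{P}$ there is $B\in H/\mathcal{Q}$ with $\mathrm{hdist}_H(q(A),B)<M$, and for every $B\in H/\mathcal{Q}$ there is $A\in G/\mathcal{P}$ with $\mathrm{hdist}_H(q(A),B)<M$. A metric space $X$ is a $\tau$-network with respect to a collection $\mathcal{L}$ of subsets if $X=\bigcup_{L\in\mathcal{L}}\mathcal{N}_\tau(L)$ and for all $L,L'\in\mathcal{L}$ there is a sequence $L=L_1,\dots,L_n=L'$ in $\mathcal{L}$ with $\mathcal{N}_\tau(L_i)\cap\mathcal{N}_\tau(L_{i+1})$ unbounded for all $i$. A group pair $(G,\mathcal{P})$ is a $\tau$-network if $\mathcal{P}$ is non-empty and $(G,\mathrm{dist}_G)$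 is a $\tau$-network with respect to $G/\mathcal{P}$. *)

(* Defs.v *)
From HB Require Import structures.
From mathcomp Require Import all_boot all_order all_algebra.
From mathcomp Require Import all_classical all_reals all_analysis.

Set Implicit Arguments.
Unset Strict Implicit.
Unset Printing Implicit Defensive.

Import Order.TTheory GRing.Theory Num.Theory.

Local Open Scope classical_set_scope.
Local Open Scope ring_scope.

Section MetricSpaces.
Context {R : realType}.

(* On a metric space the library's extended distance (an infimum of radii of
   balls) is the distance, so [edist_inf A x] is the usual dist(x, A). *)
Lemma edistE (X : metricType R) (x y : X) : edist (x, y) = (mdist x y)%:E.
Proof.
rewrite /edist; apply/le_anti/andP; split; last first.
  apply: le_ereal_inf_tmp => _ [r /= [_]] + <-.
  by rewrite ballEmdist /= lee_fin => /ltW.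
apply/lee_addgt0Pr => e e0; apply: ereal_inf_lbound.
exists (mdist x y + e) => //=; split.
  exact: (ltr_wpDl (mdist_ge0 _ _)).
by rewrite ballEmdist /= ltrDl.
Qed.

Definition closed_nbhd (X : metricType R) (r : R) (A : set X) : set X :=
  [set x | (edist_inf A x <= r%:E)%E].

Definition hdist (X : metricType R) (A B : set X) : \bar R :=
  ereal_inf [set r%:E | r in
    [set r : R | [/\ 0 <= r, A `<=` closed_nbhd r B & B `<=` closed_nbhd r A]]].

Definition metric_bounded (X : metricType R) (A : set X) : Prop :=
  exists r : R, forall x y, A x -> A y -> mdist x y <= r.

Definition quasi_isometry (X Y : metricType R) (q : X -> Y) : Prop :=
  exists L C : R, [/\ 1 <= L, 0 <= C,
    forall x y, L^-1 * mdist x y - C <= mdist (q x) (q y) <= L * mdist x y + C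
    & forall y, exists x, mdist y (q x) <= C].

Definition network (X : metricType R) (t : R) (LL : set (set X)) : Prop :=
  \bigcup_(A in LL) closed_nbhd t A = [set: X] /\
  forall A B, LL A -> LL B -> exists (n : nat) (L : nat -> set X),
    [/\ L 0%N = A, L n = B, forall i, (i <= n)%N -> LL (L i)
      & forall i, (i < n)%N ->
          ~ metric_bounded (closed_nbhd t (L i) `&` closed_nbhd t (L i.+1))].

End MetricSpaces.

Section WordMetric.
Local Open Scope group_scope.

Definition is_word (G : groupType) (S : seq G) (w : seq G) : bool :=
  all (fun x => (x \in S) || (x^-1 \in S)) w.

Definition generates (G : groupType) (S : seq G) : Prop :=
  forall g : G, exists2 w : seq G, is_word S w & g = \prod_(x <- w) x.

Record fgGroup := FgGroup {
  fg_sort :> groupType;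
  fg_gens : seq fg_sort;
  fg_gensP : generates fg_gens }.

Definition has_word_of_size (G : fgGroup) (g : G) (n : nat) : Prop :=
  exists w : seq G, [/\ size w = n, is_word (fg_gens G) w & g = \prod_(x <- w) x].

Lemma ex_word_size (G : fgGroup) (g : G) : exists n, `[< has_word_of_size g n >].
Proof.
by have [w wS ->] := fg_gensP g; exists (size w); apply/asboolP; exists w.
Qed.

Definition word_length (G : fgGroup) (g : G) : nat := ex_minn (ex_word_size g).

Lemma word_lengthP (G : fgGroup) (g : G) : has_word_of_size g (word_length g).
Proof. by rewrite /word_length; case: ex_minnP => n /asboolP. Qed.

Lemma word_length_le (G : fgGroup) (g : G) n :
  has_word_of_size g n -> (word_length g <= n)%N.
Proof.
by rewrite /word_length; case: ex_minnP => m _ min_m gn; apply/min_m/asboolP.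
Qed.

Lemma word_length1 (G : fgGroup) : word_length (1 : G) = 0%N.
Proof.
apply/eqP; rewrite -leqn0; apply: word_length_le.
by exists [::]; rewrite big_nil.
Qed.

Lemma word_length0 (G : fgGroup) (g : G) : word_length g = 0%N -> g = 1.
Proof.
by case: (word_lengthP g) => w [<- _ ->] /size0nil ->; rewrite big_nil.
Qed.

Lemma word_lengthM (G : fgGroup) (g h : G) :
  (word_length (g * h)%g <= word_length g + word_length h)%N.
Proof.
have [u [su uS ug]] := word_lengthP g; have [v [sv vS vh]] := word_lengthP h.
apply: word_length_le; exists (u ++ v).
by rewrite size_cat su sv /is_word all_cat big_cat -ug -vh; split => //; apply/andP.
Qed.

Lemma word_lengthV_le (G : fgGroup) (g : G) :
  (word_length g^-1 <= word_length g)%N.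
Proof.
have [u [su uS ug]] := word_lengthP g; rewrite -su ug.
apply: word_length_le; exists (rev [seq x^-1 | x <- u]).
split; first by rewrite size_rev size_map.
  rewrite /is_word all_rev all_map; apply: sub_all uS => x /=.
  by rewrite invgK orbC.
elim: u {su uS ug} => [|x u IHu]; first by rewrite !big_nil invg1.
by rewrite big_cons invgM IHu map_cons rev_cons -cats1 big_cat big_seq1.
Qed.

Lemma word_lengthV (G : fgGroup) (g : G) : word_length g^-1 = word_length g.
Proof.
by apply/eqP; rewrite eqn_leq word_lengthV_le -{1}[g]invgK word_lengthV_le.
Qed.

(* The underlying set of [G], as a metric space for the left-invariant
   word metric. *)
Definition word_space (R : realType) (G : fgGroup) : Type := G.

HB.instance Definition _ (R : realType) (G : fgGroup) :=
  Choice.on (word_space R G).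

Definition word_dist (R : realType) (G : fgGroup) (g h : word_space R G) : R :=
  ((word_length ((g : G)^-1 * (h : G))%g)%:R)%R.

Lemma word_distxx (R : realType) (G : fgGroup) (g : word_space R G) :
  word_dist g g = 0%R.
Proof. by rewrite /word_dist mulVg word_length1. Qed.

Lemma word_dist_eq0 (R : realType) (G : fgGroup) (g h : word_space R G) :
  word_dist g h = 0%R -> g = h.
Proof.
move=> /eqP; rewrite pnatr_eq0 => /eqP/word_length0 e.
by have := congr1 (fun x : G => (g : G) * x) e; rewrite mulgA mulgV mul1g mulg1.
Qed.

Lemma word_dist_sym (R : realType) (G : fgGroup) (g h : word_space R G) :
  word_dist g h = word_dist h g.
Proof. by rewrite /word_dist -word_lengthV invgM invgK. Qed.

Lemma word_dist_triangle (R : realType) (G : fgGroup) (h g k : word_space R G) :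
  (word_dist g k <= word_dist g h + word_dist h k)%R.
Proof.
rewrite /word_dist -natrD ler_nat.
have -> : ((g : G)^-1 * (k : G) = ((g : G)^-1 * h) * ((h : G)^-1 * k))%g.
  by rewrite mulgA -(mulgA _ h) mulgV mulg1.
exact: word_lengthM.
Qed.

HB.instance Definition _ (R : realType) (G : fgGroup) :=
  isMetric.Build R (word_space R G) (@word_distxx R G) (@word_dist_eq0 R G)
    (@word_dist_sym R G) (@word_dist_triangle R G).

End WordMetric.

Definition group_pair (G : fgGroup) (P : set (set G)) : Prop :=
  finite_set P /\
  forall A : set G, P A -> group_closed (mem A) /\ infinite_set A.

Definition left_cosets (G : fgGroup) (P : set (set G)) : set (set G) :=
  [set C | exists g : G, exists2 A, P A & C = [set (g * a)%g | a in A]].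

Definition quasi_isometric_pairs (R : realType) (G H : fgGroup)
    (P : set (set G)) (Q : set (set H)) : Prop :=
  exists q : word_space R G -> word_space R H, quasi_isometry q /\
  exists2 M : R, 0 < M &
    (forall A : set (word_space R G), left_cosets P A ->
       exists2 B : set (word_space R H),
         left_cosets Q B & (hdist (q @` A) B < M%:E)%E) /\
    (forall B : set (word_space R H), left_cosets Q B ->
       exists2 A : set (word_space R G),
         left_cosets P A & (hdist (q @` A) B < M%:E)%E).

Definition network_pair (R : realType) (G : fgGroup) (t : R)
    (P : set (set G)) : Prop :=
  P !=set0 /\ @network R (word_space R G) t (left_cosets P).

(* Main.v *)
Require Import Defs.
From mathcomp Require Import all_boot all_order all_algebra.
From mathcomp Require Import all_classical all_reals all_analysis.
From mathcomp Require Import lra.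

(** A quasi-isometry of pairs is encoded by the relation [d (y, q x) <= D],
    whose defining properties are symmetric in the two spaces, so only one
    direction has to be proved.  Along such a relation, neighborhoods of cosets
    are carried into larger neighborhoods of the corresponding cosets, and
    unbounded intersections stay unbounded.  A chain joining [A] to [A'] then
    transfers to a chain joining any prescribed [B], [B'] corresponding to
    [A], [A']; its end steps use that cosets of infinite subgroups are
    unbounded. *)

Set Implicit Arguments.
Unset Strict Implicit.
Unset Printing Implicit Defensive.

Import Order.TTheory GRing.Theory Num.Theory.

Local Open Scope classical_set_scope.
Local Open Scope ring_scope.

Section CoarseCorrespondence.
Context {R : realType}.

Lemma edist_inf_ltP (X : metricType R) (A : set X) (x : X) (r : R) :
  (edist_inf A x < r%:E)%E <-> exists2 a, A a & mdist x a < r.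
Proof.
split=> [/ereal_inf_lt[_ [a Aa <-]]|[a Aa xa]].
  by rewrite edistE lte_fin => xa; exists a.
by apply/ereal_inf_ltP; exists (edist (x, a)); [exists a | rewrite edistE lte_fin].
Qed.

(** The infimum defining [closed_nbhd] need not be attained, so a nearby point of [A] exists only at
    a strictly larger radius. *)
Lemma closed_nbhd_near (X : metricType R) (A : set X) (x : X) (r s : R) :
  r < s -> closed_nbhd r A x -> exists2 a, A a & mdist x a < s.
Proof.
by move=> rs xA; apply/edist_inf_ltP; rewrite (le_lt_trans xA)// lte_fin.
Qed.

Lemma near_closed_nbhd (X : metricType R) (A : set X) (a x : X) (r : R) :
  A a -> mdist x a <= r -> closed_nbhd r A x.
Proof.
move=> Aa xa; apply: (@le_trans _ _ (edist (x, a))).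
  by apply: ereal_inf_lbound; exists a.
by rewrite edistE lee_fin.
Qed.

(** The lower bound of a quasi-isometry appears here as an upper bound for the converse relation,
    with the same constants in both directions. *)
Definition coarse_correspondence (X Y : metricType R) (L C : R)
    (E : X -> Y -> Prop) : Prop :=
  [/\ forall x, exists y, E x y, forall y, exists x, E x y,
    forall x x' y y', E x y -> E x' y' -> mdist y y' <= L * mdist x x' + C
  & forall x x' y y', E x y -> E x' y' -> mdist x x' <= L * mdist y y' + C].

Lemma coarse_correspondenceC (X Y : metricType R) (L C : R)
    (E : X -> Y -> Prop) :
  coarse_correspondence L C E ->
  coarse_correspondence L C (fun y x => E x y).
Proof.
by move=> [Etot Esurj Elip Elip']; split=> // x x' y y'; [exact: Elip' | exact: Elip].
Qed.

(** A relational substitute for finite Hausdorff distance between the image of [A] and [B]. *)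
Definition matches (X Y : Type) (E : X -> Y -> Prop) (A : set X) (B : set Y) :=
  (forall a, A a -> exists2 b, B b & E a b) /\
  (forall b, B b -> exists2 a, A a & E a b).

Lemma matchesC (X Y : Type) (E : X -> Y -> Prop) (A : set X) (B : set Y) :
  matches E A B -> matches (fun y x => E x y) B A.
Proof. by case. Qed.

Section Transfer.
Variables (X Y : metricType R) (L C t : R) (E : X -> Y -> Prop).
Hypotheses (L0 : 0 <= L) (corrE : coarse_correspondence L C E).

Local Notation t' := (L * (t + 1) + C).

(** A point of [A] is found within [t + 1], the extra 1 paying for the unattained infimum; the
    Lipschitz-type bound of [E] then gives [t']. *)
Lemma closed_nbhd_matches (A : set X) (B : set Y) (x : X) (y : Y) :
  matches E A B -> E x y -> closed_nbhd t A x -> closed_nbhd t' B y.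
Proof.
have [_ _ lip _] := corrE => -[AB _] xy Ax.
have [|a Aa xa] := @closed_nbhd_near X A x t (t + 1) _ Ax; first by rewrite ltrDl.
have [b Bb ab] := AB a Aa; apply: near_closed_nbhd Bb _.
by rewrite (le_trans (lip _ _ _ _ xy ab))// lerD2r ler_wpM2l// ltW.
Qed.

(** Contrapositive: a diameter bound [r] in [Y] pulls back along [E] to the bound [L * r + C] in
    [X]. *)
Lemma unbounded_meet_matches (A A' : set X) (B B' : set Y) :
  matches E A B -> matches E A' B' ->
  ~ metric_bounded (closed_nbhd t A `&` closed_nbhd t A') ->
  ~ metric_bounded (closed_nbhd t' B `&` closed_nbhd t' B').
Proof.
have [tot _ _ lip] := corrE.
move=> AB AB' + [r rP]; apply; exists (L * r + C) => x x' [Ax A'x] [Ax' A'x'].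
have [[y xy] [y' xy']] := (tot x, tot x').
rewrite (le_trans (lip _ _ _ _ xy xy'))// lerD2r ler_wpM2l//.
by apply: rP; split; apply: closed_nbhd_matches; eassumption.
Qed.

Lemma network_transfer (LL : set (set X)) (MM : set (set Y)) :
  0 <= t ->
  (forall A, LL A -> ~ metric_bounded A) ->
  (forall A, LL A -> exists2 B, MM B & matches E A B) ->
  (forall B, MM B -> exists2 A, LL A & matches E A B) ->
  network t LL -> network t' MM.
Proof.
move=> t0 unbLL LLMM MMLL [cov conn]; split.
  apply/seteqP; split=> // y _; have [_ surj _ _] := corrE.
  have [x xy] := surj y; have : [set: X] x by [].
  rewrite -cov => -[A LA Ax]; have [B MB AB] := LLMM A LA.
  by exists B => //; apply: closed_nbhd_matches Ax.
move=> B B' MB MB'; have [A LA AB] := MMLL B MB; have [A' LA' AB'] := MMLL B' MB'.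
have [n [K [K0 Kn LK Kadj]]] := conn A A' LA LA'.
(* Beyond [n] the value is irrelevant; [B] is a default that makes the choice total. *)
have /choice[f fP] i : exists Z : set Y,
    (i <= n)%N -> MM Z /\ matches E (K i) Z.
  have [le_in|lt_ni] := leqP i n; last by exists B.
  by have [Z MZ KZ] := LLMM _ (LK i le_in); exists Z.
(* The partners [f 0] and [f n] may differ from [B] and [B']. So [B] replaces [f 0], and [B'] is
   appended after index [n], matched with a repeated [K n]. This also covers [n = 0], where [A = A']
   but possibly [B <> B']. *)
pose src i := K (minn i n).
pose dst i := if i == 0%N then B else if i == n.+1 then B' else f i.
have dstP i : (i <= n.+1)%N -> MM (dst i) /\ matches E (src i) (dst i).
  rewrite /src /dst; case: eqP => [-> _|_]; first by rewrite min0n K0.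
  case: eqP => [-> _|/eqP ne_i]; first by rewrite (minn_idPr (leqnSn n)) Kn.
  rewrite leq_eqVlt (negbTE ne_i) /= ltnS => le_in.
  by rewrite (minn_idPl le_in); exact: fP.
exists n.+1, dst; split=> //; first by rewrite /dst eqxx.
  by move=> i /dstP[].
move=> i; rewrite ltnS => le_in.
apply: (@unbounded_meet_matches (src i) (src i.+1)).
- by have [] := dstP i (leqW le_in).
- by have [] := dstP i.+1 le_in.
rewrite /src (minn_idPl le_in); move: le_in; rewrite leq_eqVlt => /orP[/eqP ->|lt_in].
  (* At the repeated last term the meet is a neighborhood of [K n] alone, unbounded because it
     contains [K n]. *)
  rewrite (minn_idPr (leqnSn n)) setIid => -[r rP].
  apply: (unbLL (K n) (LK n (leqnn n))); exists r => x y Kx Ky.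
  by apply: rP; [apply: near_closed_nbhd Kx _|apply: near_closed_nbhd Ky _];
    rewrite mdistxx.
by rewrite (minn_idPl lt_in); exact: Kadj.
Qed.

End Transfer.

Lemma quasi_isometry_correspondence (X Y : metricType R) (q : X -> Y) (M : R) :
  quasi_isometry q ->
  exists L C D : R, [/\ 0 <= L, 0 <= C, M <= D &
    coarse_correspondence L C (fun x y => mdist y (q x) <= D)].
Proof.
(* [D] must be at least [C] for every point of [Y] to have a partner, and at least [M] for cosets to
   match. *)
move=> [L [C [L1 C0 qlip qsurj]]]; pose D := Num.max C M.
have CD : C <= D by rewrite le_max lexx.
have MD : M <= D by rewrite le_max lexx orbT.
have D0 : 0 <= D := le_trans C0 CD.
have L0 : 0 < L := lt_le_trans ltr01 L1.
have S0 : 0 <= C + D + D by rewrite !addr_ge0.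
(* Two triangle inequalities cost [D + D]. Clearing [L^-1] from the lower bound multiplies the error
   by [L]; the upper bound tolerates this since [1 <= L]. *)
exists L, (L * (C + D + D)), D; split=> //; first exact: ltW.
  by rewrite mulr_ge0// ltW.
split=> [x|y|x x' y y' xy xy'|x x' y y' xy xy'].
- by exists (q x); rewrite mdistxx.
- by have [x xy] := qsurj y; exists x; exact: le_trans CD.
- have /andP[_ h] := qlip x x'.
  have h1 := metric_triangle y (q x) y'; have h2 := metric_triangle (q x) (q x') y'.
  rewrite (metric_sym (q x') y') in h2.
  have h3 : C + D + D <= L * (C + D + D) by rewrite ler_peMl.
  lra.
- have /andP[h _] := qlip x x'.
  have h1 := metric_triangle (q x) y (q x'); have h2 := metric_triangle y y' (q x').
  rewrite (metric_sym (q x) y) in h1.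
  have h3 : L^-1 * mdist x x' <= mdist y y' + (C + D + D) by lra.
  by rewrite -mulrDr -ler_pdivrMl.
Qed.

(** The strict bound on [hdist] yields an admissible radius [r < D], and this gap absorbs the
    unattained infimum in [closed_nbhd]. *)
Lemma hdist_matches (X Y : metricType R) (q : X -> Y) (M D : R)
    (A : set X) (B : set Y) :
  M <= D -> (hdist (q @` A) B < M%:E)%E ->
  matches (fun x y => mdist y (q x) <= D) A B.
Proof.
move=> MD /ereal_inf_lt[_ [r [_ AB BA] <-]]; rewrite lte_fin => rM.
have rD : r < D := lt_le_trans rM MD.
split=> [a Aa|b Bb].
  have [b Bb ab] := closed_nbhd_near rD (AB _ (imageP q Aa)).
  by exists b => //; rewrite metric_sym ltW.
have [_ [a Aa <-] ab] := closed_nbhd_near rD (BA _ Bb).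
by exists a => //; exact: ltW.
Qed.

End CoarseCorrespondence.

Section GroupPairs.
Local Open Scope group_scope.

(** Induction on [n]: splitting off the first letter leaves finitely many choices, the generators
    and their inverses. *)
Lemma finite_has_word_of_size (G : fgGroup) (n : nat) :
  finite_set [set g : G | has_word_of_size g n].
Proof.
elim: n => [|n IHn].
  apply: (@sub_finite_set _ _ [set 1]) => [_ [w [/size0nil -> _ ->]]|].
    by rewrite big_nil.
  exact: finite_set1.
pose S := fg_gens G ++ [seq x^-1 | x <- fg_gens G].
apply: (@sub_finite_set _ _
  [set x * h | x in [set` S] & h in [set h : G | has_word_of_size h n]]).
  move=> g [[|x w] [// [sw]]]; rewrite /is_word /= => /andP[xS wS] ->.
  exists x; last exists (\prod_(y <- w) y); last by rewrite big_cons.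
    rewrite /= mem_cat; case/orP: xS => [-> //|xS].
    by rewrite -[x]invgK map_f ?orbT.
  by exists w.
exact: finite_image2.
Qed.

Lemma finite_word_ball (G : fgGroup) (n : nat) :
  finite_set [set g : G | (word_length g <= n)%N].
Proof.
apply: (@sub_finite_set _ _
  (\bigcup_(k in `I_n.+1) [set g : G | has_word_of_size g k])).
  by move=> g gn; exists (word_length g) => //; exact: word_lengthP.
by apply: bigcup_finite => [|k _]; [exact: finite_II|exact: finite_has_word_of_size].
Qed.

(** By left invariance, a bounded set lies in the translate of a finite word ball by any of its
    points. *)
Lemma metric_bounded_finite (R : realType) (G : fgGroup)
    (A : set (word_space R G)) :
  metric_bounded A -> finite_set A.
Proof.
move=> [r rP]; have [->|/set0P[a Aa]] := eqVneq A set0; first exact: finite_set0.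
apply: (@sub_finite_set _ _ [set (a : G) * h | h in
  [set h : G | (word_length h <= Num.truncn r)%N]]); last first.
  exact/finite_image/finite_word_ball.
move=> b Ab; exists ((a : G)^-1 * (b : G)); last by rewrite mulVKg.
have /= ab := rP a b Aa Ab.
have r0 := le_trans (mdist_ge0 a b) ab.
by rewrite /= truncn_ge_nat.
Qed.

Lemma infinite_left_coset (G : fgGroup) (P : set (set G)) (A : set G) :
  group_pair P -> left_cosets P A -> infinite_set A.
Proof.
move=> [_ hP] [g [B PB ->]] fin; have [_] := hP B PB; apply.
apply: (@sub_finite_set _ _ [set g^-1 * x | x in [set g * a | a in B]]).
  by move=> b Bb; exists (g * b); [exists b|rewrite mulKg].
exact: finite_image.
Qed.

(** [network_pair] asks for a non-empty collection of subgroups, whereas the correspondence only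
    relates cosets. *)
Lemma left_cosets_neq0 (G : fgGroup) (P : set (set G)) :
  left_cosets P !=set0 <-> P !=set0.
Proof.
split=> [[_ [_ [A PA _]]]|[A PA]]; first by exists A.
by exists [set 1 * a | a in A], 1, A.
Qed.

End GroupPairs.

(** Stated for an arbitrary relation [E], so that it applies both to the one coming from [q] and to
    its converse. *)
Lemma network_pair_transfer (R : realType) (G H : fgGroup)
    (P : set (set G)) (Q : set (set H)) (L C : R)
    (E : word_space R G -> word_space R H -> Prop) :
  group_pair P -> 0 <= L -> 0 <= C ->
  coarse_correspondence L C E ->
  (forall A : set (word_space R G), left_cosets P A ->
     exists2 B : set (word_space R H), left_cosets Q B & matches E A B) ->
  (forall B : set (word_space R H), left_cosets Q B ->
     exists2 A : set (word_space R G), left_cosets P A & matches E A B) ->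
  (exists2 s : R, 0 <= s & network_pair s P) ->
  exists2 t : R, 0 <= t & network_pair t Q.
Proof.
move=> hP L0 C0 corrE PQ QP [s s0 [P0 netP]]; exists (L * (s + 1) + C).
  by rewrite addr_ge0 ?mulr_ge0 ?addr_ge0.
split.
  have /left_cosets_neq0[A PA] := P0; have [B QB _] := PQ A PA.
  by apply/left_cosets_neq0; exists B.
have unbP (A : set (word_space R G)) : left_cosets P A -> ~ metric_bounded A.
  by move=> PA /metric_bounded_finite; exact: infinite_left_coset hP PA.
apply: (network_transfer L0 corrE s0 unbP PQ QP).
exact: netP.
Qed.

Theorem theorem5p35 (R : realType) (G H : fgGroup)
    (P : set (set G)) (Q : set (set H))
    (hP : group_pair P) (hQ : group_pair Q)
    (hqi : quasi_isometric_pairs R P Q) :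
  (exists2 s : R, 0 <= s & network_pair s P) <->
  (exists2 t : R, 0 <= t & network_pair t Q).
Proof.
have [q [qi [M _ [PQ QP]]]] := hqi.
have [L [C [D [L0 C0 MD corrE]]]] := quasi_isometry_correspondence M qi.
have matchPQ (A : set (word_space R G)) : left_cosets P A ->
    exists2 B : set (word_space R H), left_cosets Q B &
      matches (fun x y => mdist y (q x) <= D) A B.
  by move=> /PQ[B QB AB]; exists B => //; exact: hdist_matches AB.
have matchQP (B : set (word_space R H)) : left_cosets Q B ->
    exists2 A : set (word_space R G), left_cosets P A &
      matches (fun x y => mdist y (q x) <= D) A B.
  by move=> /QP[A PA AB]; exists A => //; exact: hdist_matches AB.
split; first exact: network_pair_transfer hP L0 C0 corrE matchPQ matchQP.
apply: network_pair_transfer hQ L0 C0 (coarse_correspondenceC corrE) _ _.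
  by move=> B /matchQP[A PA AB]; exists A => //; exact: matchesC.
by move=> A /matchPQ[B QB AB]; exists B => //; exact: matchesC.
Qed.
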